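(* Let $A \in \mathbb{R}^{n\times n}$ be a symmetric positive definite matrix with largest eigenvalue $\lambda_{\max}$ and smallest eigenvalue $\lambda_{\min}$. Let $\widetilde{A} = cA$, where $c = 1/\sqrt{\lambda_{\max}\lambda_{\min}}$, and suppose that $\widetilde{A} \neq I$. For $s \ge 0$ let $\widetilde{P}_s = (\widetilde{A} + sI)^{-1}$. Then the following two statements hold: $$1 = \operatorname{argmin}_{s \ge 0}\ \max\left\{ \kappa(\widetilde{A}\widetilde{P}_s),\ \kappa(\widetilde{P}_s) \right\},$$ i.e. $s=1$ is the unique minimizer over $s \in [0,\infty)$ of $\max\{\kappa(\widetilde{A}\widetilde{P}_s), \kappa(\widetilde{P}_s)\}$, and $$\kappa(\widetilde{A}\widetilde{P}_1) = \kappa(\widetilde{P}_1) = \sqrt{\kappa(\widetilde{A})}.$$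
   Context: $I$ denotes the $n\times n$ identity matrix. $\kappa(M)$ denotes the 2-norm condition number of an invertible matrix $M$; for a symmetric positive definite $M$ it equals the ratio of the largest eigenvalue of $M$ to the smallest eigenvalue of $M$. *)

(* Defs.v *)
From mathcomp Require Import all_boot all_order all_algebra.
From mathcomp Require Import boolp classical_sets reals.

Set Implicit Arguments.
Unset Strict Implicit.
Unset Printing Implicit Defensive.

Import Order.TTheory GRing.Theory Num.Theory.

Local Open Scope classical_set_scope.
Local Open Scope ring_scope.

Definition spd (R : realType) (n : nat) (A : 'M[R]_n) : Prop :=
  A^T = A /\ forall x : 'cV[R]_n, x != 0 -> 0 < (x^T *m A *m x) 0 0.

(* [eigenvalue] refers to left eigenvectors; left and right eigenvalues of a
   square matrix coincide. *)
Definition largest_eigenvalue (R : realType) (n : nat) (A : 'M[R]_n) (l : R)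
    : Prop :=
  eigenvalue A l /\ forall a : R, eigenvalue A a -> a <= l.

Definition smallest_eigenvalue (R : realType) (n : nat) (A : 'M[R]_n) (l : R)
    : Prop :=
  eigenvalue A l /\ forall a : R, eigenvalue A a -> l <= a.

Definition vnorm2 (R : realType) (n : nat) (x : 'cV[R]_n) : R :=
  Num.sqrt (\sum_(i < n) x i 0 ^+ 2).

Definition mxnorm2 (R : realType) (n : nat) (M : 'M[R]_n) : R :=
  sup [set vnorm2 (M *m x) | x in [set x : 'cV[R]_n | vnorm2 x = 1]].

(* Meaningful only for invertible M, since [invmx M] is M otherwise. *)
Definition cond2 (R : realType) (n : nat) (M : 'M[R]_n) : R :=
  mxnorm2 M * mxnorm2 (invmx M).

(* The set of all minimizers of f over D; "s is the unique minimizer" reads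
   [argmin D f = [set s]]. *)
Definition argmin (R : realType) (D : set R) (f : R -> R) : set R :=
  [set s | D s /\ forall t : R, D t -> f s <= f t].

(* Main.v *)
Require Import Defs.
From mathcomp Require Import all_boot all_order all_algebra.
From mathcomp Require Import complex.
From mathcomp Require Import ring lra.
From mathcomp Require Import boolp classical_sets reals.

(** By the spectral theorem, [A] is diagonal in some orthonormal basis, and so
    every matrix built from [A] with scalars, sums, products and inverses is
    diagonal in the same basis.  The 2-norm of a matrix that is diagonal in an
    orthonormal basis is its largest entry in absolute value, so its condition
    number is the ratio of its largest to its smallest entry when the entries
    are positive ([cond2_diagonal_in]).

    The normalisation of [A] makes the extreme eigenvalues of [c *: A]
    reciprocal: call them [a < b] with [a * b = 1], where [a < b] because
    [c *: A] is not the identity.  The maps [x |-> 1 / (x + s)] and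
    [x |-> x / (x + s)] are monotone, so
      [cond2 (P s) = (b + s) / (a + s)] and
      [cond2 (At *m P s) = b (a + s) / (a (b + s))].
    The first decreases and the second increases with [s], and both equal [b]
    at [s = 1]; so their maximum exceeds [b] everywhere else
    ([shift_ratiosB]).  Finally [cond2 At = b / a = b ^+ 2].

    The orthonormal basis is taken over the complex numbers, where the spectral
    theorem for hermitian matrices applies ([symmetric_diagonal_in]).  A complex basis is enough to compute the
    2-norm of a real matrix ([mxnorm2_diagonal_in]), which is a supremum over
    real vectors only: these embed isometrically among the complex vectors,
    which bounds the norm from above, and a real eigenvalue of a real matrix has
    a real eigenvector, which shows that the bound is attained. *)

Set Implicit Arguments.
Unset Strict Implicit.
Unset Printing Implicit Defensive.

Import Order.TTheory GRing.Theory Num.Theory.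

Local Open Scope classical_set_scope.
Local Open Scope ring_scope.
Local Open Scope complex_scope.

(** * The Euclidean norm over the reals and the complex numbers *)

Definition sqnorm (C : numClosedFieldType) (n : nat) (y : 'cV[C]_n) : C :=
  \sum_i `|y i 0| ^+ 2.

Lemma sqnormE (C : numClosedFieldType) n (y : 'cV[C]_n) :
  sqnorm y = (map_mx Num.conj y^T *m y) 0 0.
Proof. by rewrite mxE; apply: eq_bigr => i _; rewrite !mxE mulrC -normCK. Qed.

Lemma sqnorm_unitary (C : numClosedFieldType) n (U : 'M[C]_n) (y : 'cV[C]_n) :
  U \is unitarymx -> sqnorm (U *m y) = sqnorm y.
Proof.
move=> Uu; rewrite !sqnormE trmx_mul map_mxM mulmxA -(mulmxA _ _ U).
by rewrite -[map_mx _ U^T]invmx_unitary // mulVmx ?unitarymx_unit // mulmx1.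
Qed.

(** * Diagonal matrices in a given basis *)

Section ConjDiag.

Variables (F : fieldType) (n : nat) (U : 'M[F]_n).
Implicit Types d e : 'rV[F]_n.

Definition conj_diag d : 'M[F]_n := invmx U *m diag_mx d *m U.

Lemma conj_diagD d e : conj_diag (d + e) = conj_diag d + conj_diag e.
Proof. by rewrite /conj_diag raddfD /= mulmxDr mulmxDl. Qed.

Lemma conj_diagZ a d : conj_diag (a *: d) = a *: conj_diag d.
Proof. by rewrite /conj_diag linearZ /= -scalemxAr -scalemxAl. Qed.

Hypothesis Uu : U \in unitmx.

Lemma conj_diag_const a : conj_diag (const_mx a) = a%:M.
Proof.
by rewrite /conj_diag diag_const_mx mul_mx_scalar -scalemxAl mulVmx // scalemx1.
Qed.

Lemma conj_diagM d e :
  conj_diag d *m conj_diag e = conj_diag (\row_j (d 0 j * e 0 j)).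
Proof. by rewrite /conj_diag -mulmx_diag !mulmxA mulmxK. Qed.

Lemma conj_diagV d : (forall j, d 0 j != 0) ->
  invmx (conj_diag d) = conj_diag (map_mx GRing.inv d).
Proof.
move=> d0; have dV : conj_diag d *m conj_diag (map_mx GRing.inv d) = 1%:M.
  rewrite conj_diagM -conj_diag_const; congr conj_diag.
  by apply/rowP => j; rewrite !mxE mulfV.
have [du _] := mulmx1_unit dV.
by rewrite -[LHS]mulmx1 -dV mulKmx.
Qed.

Lemma conj_diag_col d j :
  conj_diag d *m col j (invmx U) = d 0 j *: col j (invmx U).
Proof.
rewrite /conj_diag colE !mulmxA mulmxK // -[LHS]mulmxA.
rewrite (_ : diag_mx d *m _ = d 0 j *: delta_mx j 0); first by rewrite -scalemxAr.
rewrite mul_diag_mx; apply/matrixP => k l; rewrite !mxE.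
by case: eqP => [->|]; rewrite ?mulr0.
Qed.

Lemma col_invmx_neq0 j : col j (invmx U) != 0.
Proof.
apply/negP => /eqP Uj; have : U *m col j (invmx U) = 0 by rewrite Uj mulmx0.
rewrite colE mulmxA mulmxV // mul1mx => /matrixP/(_ j 0)/eqP.
by rewrite !mxE !eqxx oner_eq0.
Qed.

(** In the basis [U], an eigenvector [w] satisfies [w_j * d_j = a * w_j] for all
    [j]; any nonzero coordinate of [w] gives the index. *)
Lemma conj_diag_eigenvalue d a : eigenvalue (conj_diag d) a -> exists j, d 0 j = a.
Proof.
move=> /eigenvalueP [v vM v0]; pose w := v *m invmx U.
have w0 : w != 0.
  by apply: contra v0 => /eqP /(congr1 (mulmx^~ U)); rewrite /w mulmxKV // mul0mx => ->.
have wD : w *m diag_mx d = a *: w.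
  by apply: (can_inj (mulmxK Uu)); rewrite -scalemxAl /w mulmxKV // -vM !mulmxA.
have /rV0Pn [j wj] := w0.
exists j; move/rowP: wD => /(_ j).
by rewrite mul_mx_diag mxE [RHS]mxE mulrC => /(mulIf wj).
Qed.

End ConjDiag.

Lemma sqnorm_conj_diag (C : numClosedFieldType) n (U : 'M[C]_n) d y :
  U \is unitarymx ->
  sqnorm (conj_diag U d *m y) = \sum_j `|d 0 j| ^+ 2 * `|(U *m y) j 0| ^+ 2.
Proof.
move=> Uu; rewrite /conj_diag -!mulmxA sqnorm_unitary.
  by apply: eq_bigr => j _; rewrite mul_diag_mx mxE normrM exprMn.
by rewrite invmx_unitary // trmxC_unitary.
Qed.

(** * Real vectors and matrices in a complex basis *)

Section RealVectors.

Variables (R : realType) (n : nat).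
Implicit Types (x : 'cV[R]_n) (M : 'M[R]_n) (g h : 'rV[R]_n) (U : 'M[R[i]]_n).

Local Notation toC := (real_complex R).

Lemma vnorm2_sqr x : vnorm2 x ^+ 2 = \sum_i x i 0 ^+ 2.
Proof. by rewrite sqr_sqrtr // sumr_ge0 // => i _; apply: sqr_ge0. Qed.

Lemma sqnorm_real x : sqnorm (map_mx toC x) = toC (vnorm2 x ^+ 2).
Proof.
rewrite vnorm2_sqr rmorph_sum; apply: eq_bigr => i _ /=; rewrite mxE.
by rewrite normc_def /= expr0n addr0 -!rmorphXn /= sqrtr_sqr real_normK ?num_real.
Qed.

Lemma vnorm2Z (a : R) x : vnorm2 (a *: x) = `|a| * vnorm2 x.
Proof.
rewrite -sqrtr_sqr -sqrtrM ?sqr_ge0 // mulr_sumr; congr (Num.sqrt _).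
by apply: eq_bigr => i _; rewrite mxE exprMn.
Qed.

Lemma vnorm2_gt0 x : x != 0 -> 0 < vnorm2 x.
Proof.
move=> x0; rewrite sqrtr_gt0 lt_neqAle eq_sym sumr_ge0 => [|i _]; last exact: sqr_ge0.
rewrite andbT; apply: contra x0 => /eqP s0; apply/eqP/colP => i.
move/eqP: s0; rewrite psumr_eq0 => [|j _]; last exact: sqr_ge0.
by move=> /allP /(_ i (mem_index_enum _)) /=; rewrite sqrf_eq0 mxE => /eqP.
Qed.

(** The matrix and its diagonal are real, whereas the basis may be complex. *)
Definition diagonal_in U g M : Prop :=
  map_mx toC M = conj_diag U (map_mx toC g).

(** Over the complex numbers, a real symmetric matrix is hermitian, hence its
    eigenvalues are real. *)
Lemma symmetric_diagonal_in M : M^T = M ->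
  exists U g, U \is unitarymx /\ diagonal_in U g M.
Proof.
move=> Msym; set B := map_mx toC M.
have Bherm : B \is hermsymmx.
  apply: realsym_hermsym.
    apply/is_hermitianmxP; rewrite expr0 scale1r map_mx_id //.
    by rewrite /B map_trmx Msym.
  by apply/mxOverP => i j; rewrite mxE complex_real.
have /hermitian_normalmx /orthomx_spectralP eqB := Bherm.
have /mxOverP dreal := hermitian_spectral_diag_real Bherm.
exists (spectralmx B), (map_mx (@complex.Re R) (spectral_diag B)).
split; first exact: spectral_unitarymx.
rewrite /diagonal_in -/B [LHS]eqB -/(conj_diag _ _); congr conj_diag.
by apply/rowP => j; rewrite !mxE RRe_real.
Qed.

Lemma diagonal_inD U g h M N :
  diagonal_in U g M -> diagonal_in U h N -> diagonal_in U (g + h) (M + N).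
Proof. by move=> gM hN; rewrite /diagonal_in !map_mxD gM hN conj_diagD. Qed.

Lemma diagonal_inZ U g M (a : R) :
  diagonal_in U g M -> diagonal_in U (a *: g) (a *: M).
Proof. by move=> gM; rewrite /diagonal_in !map_mxZ gM conj_diagZ. Qed.

Lemma diagonal_in_scalar U (a : R) :
  U \in unitmx -> diagonal_in U (const_mx a) a%:M.
Proof.
by move=> Uu; rewrite /diagonal_in map_scalar_mx map_const_mx conj_diag_const.
Qed.

Lemma diagonal_inM U g h M N : U \in unitmx ->
  diagonal_in U g M -> diagonal_in U h N ->
  diagonal_in U (\row_j (g 0 j * h 0 j)) (M *m N).
Proof.
move=> Uu gM hN; rewrite /diagonal_in map_mxM gM hN (conj_diagM Uu).
by congr conj_diag; apply/rowP => j; rewrite !mxE rmorphM.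
Qed.

Lemma diagonal_in_inj U g M N :
  diagonal_in U g M -> diagonal_in U g N -> M = N.
Proof. by move=> gM gN; apply: (@map_mx_inj _ _ toC); rewrite gM gN. Qed.

Lemma diagonal_inV U g M : U \in unitmx -> (forall j, g 0 j != 0) ->
  diagonal_in U g M -> diagonal_in U (map_mx GRing.inv g) (invmx M).
Proof.
move=> Uu g0 gM; rewrite /diagonal_in map_invmx gM.
have toCg0 j : map_mx toC g 0 j != 0 by rewrite mxE fmorph_eq0.
rewrite (conj_diagV Uu toCg0); congr conj_diag.
by apply/rowP => j; rewrite !mxE fmorphV.
Qed.

(** A column of [invmx U] is a complex eigenvector of [M]; since [M] and the
    eigenvalue are real, there is a real eigenvector as well. *)
Lemma diagonal_in_eigenvector U g M j : U \in unitmx -> diagonal_in U g M ->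
  exists2 x : 'cV[R]_n, x != 0 & M *m x = g 0 j *: x.
Proof.
(* [eigenvalue] is about row vectors, hence the transposition *)
move=> Uu gM; suff : eigenvalue M^T (g 0 j).
  case/eigenvalueP => v vM v0; exists v^T; first by rewrite trmx_eq0.
  by rewrite -[M]trmxK -trmx_mul vM linearZ.
rewrite -(eigenvalue_map toC); apply/eigenvalueP.
exists (col j (invmx U))^T; last by rewrite trmx_eq0 col_invmx_neq0.
by rewrite -map_trmx -trmx_mul gM (conj_diag_col Uu) linearZ mxE.
Qed.

Lemma diagonal_in_eigenvalue U g M a : U \in unitmx -> diagonal_in U g M ->
  eigenvalue M a -> exists j, g 0 j = a.
Proof.
move=> Uu gM; rewrite -(eigenvalue_map toC) gM => /(conj_diag_eigenvalue Uu)[j].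
by rewrite mxE => /complexI; exists j.
Qed.

(** * Norms and condition numbers *)

(** In the coordinates [U *m x], the matrix multiplies the [j]-th coordinate by
    [g 0 j], and passing to these coordinates preserves the norm. *)
Lemma diagonal_in_vnorm2_le U g M (b : R) x : U \is unitarymx ->
  0 <= b -> (forall j, `|g 0 j| <= b) -> diagonal_in U g M ->
  vnorm2 (M *m x) <= b * vnorm2 x.
Proof.
move=> Uu b0 gb gM; rewrite -(@ler_pXn2r _ 2) ?nnegrE ?mulr_ge0 ?sqrtr_ge0 //.
rewrite exprMn -lecR -/toC -sqnorm_real map_mxM gM rmorphM /= -sqnorm_real.
rewrite (sqnorm_conj_diag _ _ Uu) -(sqnorm_unitary (map_mx toC x) Uu).
rewrite mulr_sumr; apply: ler_sum => j _; rewrite mxE ler_wpM2r ?exprn_ge0 //.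
rewrite normc_def /= expr0n addr0 -rmorphXn /= lecR sqrtr_sqr.
by rewrite ler_pXn2r ?nnegrE.
Qed.

(** The supremum is a maximum: it is attained at a normalised real eigenvector
    for [g 0 i]. *)
Lemma mxnorm2_diagonal_in U g M i : U \is unitarymx ->
  (forall j, `|g 0 j| <= `|g 0 i|) -> diagonal_in U g M ->
  mxnorm2 M = `|g 0 i|.
Proof.
move=> Uu gi gM; rewrite /mxnorm2.
set S := [set _ | _ in _].
have Sub : ubound S `|g 0 i|.
  move=> _ [x /= x1 <-]; rewrite -[leRHS]mulr1 -x1.
  exact: diagonal_in_vnorm2_le gM.
have Smem : S `|g 0 i|.
  have [x x0 Mx] := diagonal_in_eigenvector i (unitarymx_unit Uu) gM.
  have xp := vnorm2_gt0 x0.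
  have x1 : vnorm2 ((vnorm2 x)^-1 *: x) = 1.
    by rewrite vnorm2Z ger0_norm ?invr_ge0 ?ltW // mulVf ?gt_eqF.
  exists ((vnorm2 x)^-1 *: x) => //.
  by rewrite -scalemxAr Mx scalerA mulrC -scalerA vnorm2Z x1 mulr1.
apply/eqP; rewrite eq_le ge_sup ?ub_le_sup //; by exists `|g 0 i|.
Qed.

(** The eigenvalues of [invmx M] are the inverses of the entries of [g], so that
    the smallest entry of [g] gives the norm of the inverse. *)
Lemma cond2_diagonal_in U g M i k : U \is unitarymx -> (forall j, 0 < g 0 j) ->
  (forall j, g 0 k <= g 0 j <= g 0 i) -> diagonal_in U g M ->
  cond2 M = g 0 i / g 0 k.
Proof.
move=> Uu g0 gb gM; have Uunit := unitarymx_unit Uu.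
have gV := diagonal_inV Uunit (fun j => lt0r_neq0 (g0 j)) gM.
rewrite /cond2 (mxnorm2_diagonal_in (i := i) Uu _ gM); last first.
  by move=> j; rewrite !gtr0_norm //; case/andP: (gb j).
rewrite (mxnorm2_diagonal_in (i := k) Uu _ gV); last first.
  move=> j; rewrite !mxE !gtr0_norm ?invr_gt0 // lef_pV2 ?posrE //.
  by case/andP: (gb j).
by rewrite mxE !gtr0_norm ?invr_gt0.
Qed.

Lemma spd_eigenvalue_gt0 M a : spd M -> eigenvalue M a -> 0 < a.
Proof.
move=> [_ Mpos] /eigenvalueP [v vM v0].
have vT0 : v^T != 0 by rewrite trmx_eq0.
have := Mpos _ vT0; rewrite trmxK vM -scalemxAl mxE.
rewrite (_ : (v *m v^T) 0 0 = vnorm2 v^T ^+ 2) ?pmulr_lgt0 ?exprn_gt0 ?vnorm2_gt0 //.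
by rewrite vnorm2_sqr mxE; apply: eq_bigr => i _; rewrite mxE.
Qed.

End RealVectors.

(** * The optimal shift *)

Section Shift.

Variables (R : realType) (n : nat) (U : 'M[R[i]]_n) (g : 'rV[R]_n).
Variables (M : 'M[R]_n) (i k : 'I_n) (s : R).
Hypotheses (Uu : U \is unitarymx) (g0 : forall j, 0 < g 0 j).
Hypotheses (gb : forall j, g 0 k <= g 0 j <= g 0 i) (gM : diagonal_in U g M).
Hypothesis s0 : 0 <= s.

Let Uunit := unitarymx_unit Uu.

Let gs0 j : 0 < g 0 j + s.
Proof. exact: ltr_wpDr. Qed.

Let inv_shift : diagonal_in U (map_mx GRing.inv (g + s *: const_mx 1))
                             (invmx (M + s *: 1%:M)).
Proof.
apply: (diagonal_inV Uunit) => [j|].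
  by rewrite !mxE mulr1 gt_eqF.
exact: (diagonal_inD gM (diagonal_inZ s (diagonal_in_scalar 1 Uunit))).
Qed.

(* [x |-> 1 / (x + s)] is decreasing, so [i] and [k] exchange roles *)
Lemma cond2_inv_shift : cond2 (invmx (M + s *: 1%:M)) = (g 0 i + s) / (g 0 k + s).
Proof.
rewrite (cond2_diagonal_in (i := k) (k := i) Uu _ _ inv_shift).
- by rewrite !mxE !mulr1 invrK mulrC.
- by move=> j; rewrite !mxE mulr1 invr_gt0.
- move=> j; rewrite !mxE mulr1 !lef_pV2 ?posrE // !lerD2r andbC.
  exact: gb.
Qed.

Lemma cond2_mul_inv_shift :
  cond2 (M *m invmx (M + s *: 1%:M)) =
  (g 0 i / (g 0 i + s)) / (g 0 k / (g 0 k + s)).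
Proof.
have frac_le p q : g 0 p <= g 0 q -> g 0 p / (g 0 p + s) <= g 0 q / (g 0 q + s).
  move=> pq; rewrite ler_pdivrMr // mulrAC ler_pdivlMr // !mulrDr mulrC lerD2l.
  by rewrite ler_wpM2r.
rewrite (cond2_diagonal_in (i := i) (k := k) Uu _ _ (diagonal_inM Uunit gM inv_shift)).
- by rewrite !mxE !mulr1.
- by move=> j; rewrite !mxE mulr1 divr_gt0.
- by move=> j; rewrite !mxE !mulr1 !frac_le //; case/andP: (gb j).
Qed.

End Shift.

(** Both ratios are compared with their common value [b] at [s = 1].  When
    [a < 1 < b], the differences have the signs of [1 - s] and [s - 1], so that
    one of the ratios exceeds [b] as soon as [s] differs from 1. *)
Lemma shift_ratiosB (R : realFieldType) (a b s : R) :
  0 < a -> 0 < b -> a * b = 1 -> 0 <= s ->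
  (b + s) / (a + s) - b = (b - 1) / (a + s) * (1 - s) /\
  (b / (b + s)) / (a / (a + s)) - b = b * (1 - a) / (a * (b + s)) * (s - 1).
Proof.
move=> a0 b0 ab1 s0.
have -> : a = b^-1 by rewrite -(mulfK (lt0r_neq0 b0) a) ab1 mul1r.
have as0 : 1 + s * b != 0 by rewrite gt_eqF // ltr_pwDl // mulr_ge0 // ltW.
have bs0 : b + s != 0 by rewrite gt_eqF // ltr_pwDl.
by split; field; rewrite ?as0 ?bs0 (lt0r_neq0 b0).
Qed.

Theorem theorem2 (R : realType) (n : nat) (A : 'M[R]_n) (lmax lmin : R)
    (A_spd : spd A)
    (lmaxP : largest_eigenvalue A lmax) (lminP : smallest_eigenvalue A lmin) :
  let c : R := 1 / Num.sqrt (lmax * lmin) in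
  let At : 'M[R]_n := c *: A in
  let P : R -> 'M[R]_n := fun s => invmx (At + s *: 1%:M) in
  At <> 1%:M ->
  argmin [set s : R | 0 <= s]
         (fun s => Num.max (cond2 (At *m P s)) (cond2 (P s))) = [set 1]
  /\ (cond2 (At *m P 1) = cond2 (P 1) /\ cond2 (P 1) = Num.sqrt (cond2 At)).
Proof.
move=> c At P At1.
have [U [e [Uu eA]]] := symmetric_diagonal_in (proj1 A_spd).
have Uunit := unitarymx_unit Uu.
have e_eig j : eigenvalue A (e 0 j).
  have [x x0 Ax] := diagonal_in_eigenvector j Uunit eA.
  apply/eigenvalueP; exists x^T; last by rewrite trmx_eq0.
  by rewrite -[A]trmxK -trmx_mul (proj1 A_spd) Ax linearZ.
have e0 j : 0 < e 0 j by apply: spd_eigenvalue_gt0 A_spd (e_eig j).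
have [lmax_eig lmax_ge] := lmaxP.
have [lmin_eig lmin_le] := lminP.
have [i ei] := diagonal_in_eigenvalue Uunit eA lmax_eig.
have [k ek] := diagonal_in_eigenvalue Uunit eA lmin_eig.
have lmax0 : 0 < lmax by rewrite -ei.
have lmin0 : 0 < lmin by rewrite -ek.
have c0 : 0 < c by rewrite divr_gt0 ?sqrtr_gt0 ?mulr_gt0.
have c2 : (c * lmin) * (c * lmax) = 1.
  rewrite (_ : _ * _ = c ^+ 2 * (lmax * lmin)); last by ring.
  rewrite /c div1r exprVn sqr_sqrtr ?mulVf // ?mulf_neq0 ?gt_eqF //.
  by rewrite ltW // mulr_gt0.
have gAt : diagonal_in U (c *: e) At by apply: diagonal_inZ.
have g0 j : 0 < (c *: e) 0 j by rewrite mxE mulr_gt0.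
have gb j : (c *: e) 0 k <= (c *: e) 0 j <= (c *: e) 0 i.
  by rewrite !mxE !ler_pM2l // ei ek lmin_le ?lmax_ge.
set a : R := (c *: e) 0 k in g0 gb; set b : R := (c *: e) 0 i in g0 gb.
have a0 : 0 < a by apply: g0.
have ab1 : a * b = 1 by rewrite /a /b !mxE ei ek.
have ab : a < b.
  have /andP[ab _] := gb i; rewrite lt_neqAle ab andbT.
  apply/eqP => abE; case: At1; apply: (diagonal_in_inj gAt).
  (* if [a = b], then [a ^+ 2 = 1] and all the eigenvalues are equal to 1 *)
  have -> : c *: e = const_mx 1.
    have a1 : a = 1.
      by apply/eqP; rewrite -(@pexpr_eq1 _ _ 2) // ?ltW // expr2 {2}abE ab1.
    apply/rowP => j; have := gb j; rewrite -abE a1 [RHS]mxE => gj.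
    by apply/eqP; rewrite eq_le andbC.
  exact: diagonal_in_scalar.
have PE (s : R) : 0 <= s -> cond2 (P s) = (b + s) / (a + s).
  exact: (cond2_inv_shift Uu g0 gb gAt).
have APE (s : R) : 0 <= s -> cond2 (At *m P s) = (b / (b + s)) / (a / (a + s)).
  exact: (cond2_mul_inv_shift Uu g0 gb gAt).
have b0 : 0 < b by apply: g0.
have a1 : a < 1 by nra.
have b1 : 1 < b by nra.
have PB (s : R) : 0 <= s -> cond2 (P s) - b = (b - 1) / (a + s) * (1 - s).
  by move=> s0; rewrite PE //; have [] := shift_ratiosB a0 b0 ab1 s0.
have APB (s : R) : 0 <= s ->
    cond2 (At *m P s) - b = b * (1 - a) / (a * (b + s)) * (s - 1).
  by move=> s0; rewrite APE //; have [] := shift_ratiosB a0 b0 ab1 s0.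
have P1 : cond2 (P 1) = b by apply/eqP; rewrite -subr_eq0 PB // subrr mulr0.
have AP1 : cond2 (At *m P 1) = b.
  by apply/eqP; rewrite -subr_eq0 APB // subrr mulr0.
have Ppos (s : R) : 0 <= s -> 0 < (b - 1) / (a + s).
  by move=> s0; rewrite divr_gt0 ?subr_gt0 ?ltr_pwDl.
have APpos (s : R) : 0 <= s -> 0 < b * (1 - a) / (a * (b + s)).
  by move=> s0; rewrite divr_gt0 ?mulr_gt0 ?subr_gt0 ?ltr_pwDl.
split; last first.
  split; first by rewrite AP1 P1.
  rewrite (cond2_diagonal_in (i := i) (k := k) Uu g0 gb gAt) -/a -/b P1.
  rewrite (_ : b / a = b ^+ 2) ?sqrtr_sqr ?gtr0_norm //.
  by apply: (canLR (mulfK (lt0r_neq0 a0))); rewrite expr2 -mulrA [b * a]mulrC ab1 mulr1.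
apply/seteqP; split => s /=.
  move=> [s0 /(_ 1 ler01)]; rewrite AP1 P1 maxxx ge_max -!(subr_le0 b).
  rewrite (PB s s0) (APB s s0) (pmulr_rle0 _ (Ppos s s0)).
  rewrite (pmulr_rle0 _ (APpos s s0)) !subr_le0 => les.
  by apply/eqP; rewrite eq_le.
move=> ->; split=> [|t t0]; first exact: ler01.
rewrite AP1 P1 maxxx le_max -!(subr_ge0 b).
rewrite (PB t t0) (APB t t0) (pmulr_rge0 _ (Ppos t t0)).
by rewrite (pmulr_rge0 _ (APpos t t0)) !subr_ge0 le_total.
Qed.
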